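(* Let $\mathcal{V}$ be a finite token vocabulary, let $\theta$ be a language model over $\mathcal{V}$ with last-layer hidden dimension $d$ and vocabulary projection matrix $W \in \mathbb{R}^{|\mathcal{V}| \times d}$, and let $\theta^*$ be the ideal model associated with $\theta$ (the optimally prompted version of $\theta$, having the same architecture and weights, in particular the same matrix $W$). Then for every input $\mathbf{x}$, every timestep $t$ and every sequence $\mathbf{y}_{<t}$ of previously generated tokens, the next-token distributions on $\mathcal{V}$ satisfy $$\mathrm{KL}\!\left(P(y_t \mid \mathbf{y}_{<t}, \mathbf{x}, \theta^* ) \,\|\, P(y_t \mid \mathbf{y}_{<t}, \mathbf{x}, \theta)\right) \;\le\; 2\, \|W\| \, \|h_t^* - h_t\|,$$ where $h_t \in \mathbb{R}^d$ and $h_t^* \in \mathbb{R}^d$ are the last-layer hidden states at timestep $t$ of the actual model $\theta$ and of the ideal model $\theta^*$, respectively, $\|h_t^*-h_t\|$ is the Euclidean norm, and $\|W\|$ is the operator norm of $W$ induced by the Euclidean norms.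
   Context: Next-token distributions. A language model $\theta$ with last-layer hidden state $h_t \in \mathbb{R}^d$ at timestep $t$ (a function of the input, of any prompt, and of the previously generated tokens $\mathbf{y}_{<t}$) assigns to token $i \in \mathcal{V}$ the probability $$P(y_t = i \mid \mathbf{y}_{<t}, \mathbf{x}, \theta) = \frac{e^{V_i^\top W h_t}}{\sum_{j \in \mathcal{V}} e^{V_j^\top W h_t}},$$ where $V_i \in \mathbb{R}^{|\mathcal{V}|}$ is the one-hot (standard basis) vector of token $i$; that is, the distribution is $\mathrm{softmax}(W h_t)$. The ideal model's distribution is given by the same formula with $h_t$ replaced by $h_t^*$ and the same $W$. Ideal model. Let $P^*(\cdot \mid \mathbf{x})$ denote the (unknown) true token generation distribution, and $\mathcal{D}$ the data distribution of the language modeling task. Let $\mathbf{s}^* = (s_1,\dots,s_n)$ be a token sequence (prompt) with $$\mathbf{s}^* \in \arg\min_{\mathbf{s}} \ \mathbb{E}_{\mathbf{x}\sim\mathcal{D}}\left[\mathrm{KL}\left(P^*(\cdot\mid\mathbf{x}) \,\|\, P(\cdot\mid\mathbf{x},\mathbf{s},\theta)\right)\right],$$ where $P(\cdot\mid\mathbf{x},\mathbf{s},\theta)$ is the output distribution of $\theta$ when it is additionally given the prompt $\mathbf{s}$. The ideal model $\theta^*$ is the model $\theta$ run with the additional prompt $\mathbf{s}^*$: $P(\cdot\mid\mathbf{x},\theta^* ) := P(\cdot\mid\mathbf{x},\mathbf{s}^*,\theta)$. Thus $\theta$ and $\theta^*$ share architecture and weights (including $W$) and differ only in their activations; $h_t^*$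 is the last-layer hidden state of $\theta$ at timestep $t$ when run with the prompt $\mathbf{s}^*$. KL divergence uses the natural logarithm: $\mathrm{KL}(p\|q) = \sum_{i\in\mathcal{V}} p_i \ln(p_i/q_i)$. *)

(* Defs.v *)
From mathcomp Require Import all_boot all_order all_algebra.
From mathcomp Require Import all_classical all_reals all_analysis.

Set Implicit Arguments.
Unset Strict Implicit.
Unset Printing Implicit Defensive.

Import Order.TTheory GRing.Theory Num.Theory.

Local Open Scope classical_set_scope.
Local Open Scope ring_scope.

(* The library's norm on matrices is the sup norm, hence these two. *)
Definition enorm (R : realType) (n : nat) (v : 'cV[R]_n) : R :=
  Num.sqrt (\sum_i v i 0 ^+ 2).

(* The set is nonempty (it contains 0) and bounded above, so [sup] is the
   genuine supremum, including when [n = 0]. *)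
Definition opnorm (R : realType) (m n : nat) (A : 'M[R]_(m, n)) : R :=
  sup [set enorm (A *m v) | v in [set v : 'cV[R]_n | enorm v <= 1]].

Definition is_distr (R : realType) (T : finType) (p : T -> R) : Prop :=
  (forall i, 0 <= p i) /\ \sum_i p i = 1.

(* Since [ln 0 = 0], this has the usual convention [0 ln 0 = 0].  It is only
   used with an everywhere positive [q], so the value +oo never arises. *)
Definition KL (R : realType) (T : finType) (p q : T -> R) : R :=
  \sum_i p i * ln (p i / q i).

(* [hidden x s y] is the last-layer hidden state on input [x] with prompt [s]
   after the tokens [y] have been generated; [s = [::]] means no prompt. *)
Record lang_model (R : realType) (V : finType) (X : Type) (d : nat) :=
  LangModel {
    unembed : 'M[R]_(#|V|, d);
    hidden : X -> seq V -> seq V -> 'cV[R]_d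
  }.

Definition onehot (R : realType) (V : finType) (i : V) : 'cV[R]_#|V| :=
  delta_mx (enum_rank i) 0.

Section LanguageModel.
Variables (R : realType) (V : finType) (d : nat).

Definition logit X (theta : lang_model R V X d)
    (x : X) (s y : seq V) (i : V) : R :=
  ((onehot R i)^T *m unembed theta *m hidden theta x s y) 0 0.

Definition next_token X (theta : lang_model R V X d)
    (x : X) (s y : seq V) (i : V) : R :=
  expR (logit theta x s y i) / \sum_(j : V) expR (logit theta x s y j).

(* Distribution of the first [T] generated tokens, by the chain rule. *)
Definition output X (theta : lang_model R V X d)
    (T : nat) (x : X) (s : seq V) (y : T.-tuple V) : R :=
  \prod_(t < T) next_token theta x s (take t y) (tnth y t).

Definition prompt_loss (dX : measure_display) (X : measurableType dX)
    (D : probability X R) (T : nat) (Pstar : X -> T.-tuple V -> R)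
    (theta : lang_model R V X d) (s : seq V) : \bar R :=
  'E_D[fun x => KL (Pstar x) (output theta x s)].

Definition optimal_prompt (dX : measure_display) (X : measurableType dX)
    (D : probability X R) (T : nat) (Pstar : X -> T.-tuple V -> R)
    (theta : lang_model R V X d) (n : nat) (s : n.-tuple V) : Prop :=
  forall s' : n.-tuple V,
    (prompt_loss D Pstar theta s <= prompt_loss D Pstar theta s')%E.

(* [theta] run with the additional prompt [s]: same weights, new activations. *)
Definition prompted X (theta : lang_model R V X d) (s : seq V) :
    lang_model R V X d :=
  {| unembed := unembed theta;
     hidden := fun x s' y => hidden theta x (s ++ s') y |}.

Definition ideal_model (dX : measure_display) (X : measurableType dX)
    (D : probability X R) (T : nat) (Pstar : X -> T.-tuple V -> R)
    (n : nat) (theta thetastar : lang_model R V X d) : Prop :=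
  exists2 s : n.-tuple V,
    optimal_prompt D Pstar theta s & thetastar = prompted theta s.

End LanguageModel.

(* Main.v *)
Require Import Defs.
From mathcomp Require Import all_boot all_order all_algebra.
From mathcomp Require Import all_classical all_reals all_analysis.
From mathcomp Require Import lra.

Import Order.TTheory GRing.Theory Num.Theory.
Local Open Scope ring_scope.

(** Each logit moves by at most [M := |W (h* - h)| <= |W| |h* - h|] between the
    two models, so the log-partition function also moves by at most [M]. Every
    log-ratio of probabilities is then at most [2 M], and the divergence is an
    average of these log-ratios. *)

Section EuclideanNorm.
Context {R : realType}.

Lemma enorm_ge0 n (v : 'cV[R]_n) : 0 <= enorm v.
Proof. exact: sqrtr_ge0. Qed.

Lemma enorm0 n : enorm (0 : 'cV[R]_n) = 0.
Proof.
by rewrite /enorm big1 ?sqrtr0 // => i _; rewrite mxE expr0n.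
Qed.

Lemma enormZ n (c : R) (v : 'cV[R]_n) : enorm (c *: v) = `|c| * enorm v.
Proof.
rewrite /enorm -sqrtr_sqr -sqrtrM ?sqr_ge0 // mulr_sumr.
by congr Num.sqrt; apply: eq_bigr => i _; rewrite mxE exprMn.
Qed.

Lemma coord_le_enorm n (v : 'cV[R]_n) i : `|v i 0| <= enorm v.
Proof.
rewrite /enorm -sqrtr_sqr ler_sqrt; last by apply: sumr_ge0 => j _; exact: sqr_ge0.
by rewrite (bigD1 i) //= lerDl; apply: sumr_ge0 => j _; exact: sqr_ge0.
Qed.

Lemma enorm_eq0 n (v : 'cV[R]_n) : enorm v = 0 -> v = 0.
Proof.
move=> v0; apply/colP => i; rewrite mxE; apply/eqP.
by rewrite -normr_le0 -v0 coord_le_enorm.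
Qed.

Lemma le_enorm n (u v : 'cV[R]_n) :
  (forall i, `|u i 0| <= v i 0) -> enorm u <= enorm v.
Proof.
move=> uv; apply: ler_wsqrtr; apply: ler_sum => i _.
by rewrite -(real_normK (num_real (u i 0))) lerXn2r ?nnegrE // (le_trans _ (uv i)).
Qed.

(** This is what makes [sup] an actual upper bound. On the unit ball every coordinate has modulus at
    most 1, so the entries of [A *m v] are dominated by the absolute row sums of [A]. *)
Lemma opnorm_has_ubound m n (A : 'M[R]_(m, n)) :
  has_ubound [set enorm (A *m v) | v in [set v : 'cV[R]_n | enorm v <= 1]]%classic.
Proof.
exists (enorm (\col_i \sum_j `|A i j|)) => _ [v /= v1 <-].
apply: le_enorm => i; rewrite !mxE.
apply: (le_trans (ler_norm_sum _ _ _)); apply: ler_sum => j _.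
by rewrite normrM ler_piMr // (le_trans (coord_le_enorm _ _ _)).
Qed.

Lemma enorm_mulmx_unit m n (A : 'M[R]_(m, n)) (v : 'cV[R]_n) :
  enorm v <= 1 -> enorm (A *m v) <= opnorm A.
Proof.
move=> v1; apply: ub_le_sup; first exact: opnorm_has_ubound.
by exists v.
Qed.

Lemma enorm_mulmx m n (A : 'M[R]_(m, n)) (v : 'cV[R]_n) :
  enorm (A *m v) <= opnorm A * enorm v.
Proof.
have [/enorm_eq0 ->|v0] := eqVneq (enorm v) 0.
  by rewrite mulmx0 !enorm0 mulr0.
have v_gt0 : 0 < enorm v by rewrite lt0r v0 enorm_ge0.
(* Dividing by [enorm v] and moving the scalar inside the norm reduces the claim to the normalized
   vector. *)
rewrite -ler_pdivrMr // mulrC -[(enorm v)^-1]ger0_norm ?invr_ge0 ?enorm_ge0 //.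
rewrite -enormZ scalemxAr; apply: enorm_mulmx_unit.
by rewrite enormZ ger0_norm ?invr_ge0 ?enorm_ge0 // mulVf.
Qed.

End EuclideanNorm.

Section Softmax.
Context {R : realType} {V : finType}.

Definition softmax (a : V -> R) (i : V) : R := expR (a i) / \sum_j expR (a j).

(** The index [i] only witnesses that [V] is nonempty; otherwise the sum would be 0. *)
Lemma sum_expR_gt0 (a : V -> R) (i : V) : 0 < \sum_j expR (a j).
Proof.
rewrite (bigD1 i) //= ltr_pwDl ?expR_gt0 //.
by apply: sumr_ge0 => j _; exact: expR_ge0.
Qed.

Lemma softmax_gt0 (a : V -> R) i : 0 < softmax a i.
Proof. by rewrite divr_gt0 ?expR_gt0 // (sum_expR_gt0 _ i). Qed.

(* Only an inequality because [V] may be empty. *)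
Lemma sum_softmax_le1 (a : V -> R) : \sum_i softmax a i <= 1.
Proof.
rewrite -mulr_suml.
have [->|S0] := eqVneq (\sum_j expR (a j)) 0; first by rewrite mul0r.
by rewrite divff.
Qed.

Lemma ln_softmax (a : V -> R) i :
  ln (softmax a i) = a i - ln (\sum_j expR (a j)).
Proof. by rewrite ln_div ?posrE ?expR_gt0 ?expRK // (sum_expR_gt0 _ i). Qed.

(** Termwise, [expR (a j)] is at most [expR M * expR (b j)]; the common factor leaves the logarithm
    as [M]. *)
Lemma ln_sum_expR_le (a b : V -> R) (M : R) (i : V) :
  (forall j, a j <= M + b j) ->
  ln (\sum_j expR (a j)) <= M + ln (\sum_j expR (b j)).
Proof.
move=> ab; rewrite -[M in M + _]expRK -lnM ?posrE ?expR_gt0 ?(sum_expR_gt0 _ i) //.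
rewrite ler_ln ?posrE ?mulr_gt0 ?expR_gt0 ?(sum_expR_gt0 _ i) //.
rewrite mulr_sumr; apply: ler_sum => j _.
by rewrite -expRD ler_expR.
Qed.

Lemma KL_softmax_le (a b : V -> R) (M : R) : 0 <= M ->
  (forall i, `|b i - a i| <= M) -> KL (softmax b) (softmax a) <= 2 * M.
Proof.
move=> M0 abM; have M20 : 0 <= 2 * M by rewrite mulr_ge0.
(* Weighting [2 * M] by the total mass of [softmax b] allows a comparison term by term. *)
apply: le_trans (ler_piMl M20 (sum_softmax_le1 b)).
rewrite mulr_suml; apply: ler_sum => i _.
rewrite ler_pM2l ?softmax_gt0 // ln_div ?posrE ?softmax_gt0 // !ln_softmax.
(* The log-ratio is [b i - a i] plus the difference of log-partition functions, [a] minus [b]; each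
   part contributes one [M]. *)
have lnZ : ln (\sum_j expR (a j)) <= M + ln (\sum_j expR (b j)).
  apply: (ln_sum_expR_le _ _ _ i) => j.
  by have [+ _] := ler_normlP _ _ (abM j); lra.
have [_ bi] := ler_normlP _ _ (abM i).
lra.
Qed.

End Softmax.

Lemma logitE (R : realType) (V : finType) d X (theta : lang_model R V X d) x s y i :
  logit theta x s y i = (unembed theta *m hidden theta x s y) (enum_rank i) 0.
Proof. by rewrite /logit -mulmxA trmx_delta -rowE mxE. Qed.

Theorem lemma1 (R : realType) (V : finType) (d : nat)
    (dX : measure_display) (X : measurableType dX) (D : probability X R)
    (T : nat) (Pstar : X -> T.-tuple V -> R)
    (Pstar_distr : forall x : X, is_distr (Pstar x))
    (n : nat) (theta thetastar : lang_model R V X d)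
    (thetastar_ideal : ideal_model D Pstar n theta thetastar)
    (x : X) (t : nat) (y : t.-tuple V) :
  KL (next_token thetastar x [::] y) (next_token theta x [::] y)
    <= 2 * opnorm (unembed theta)
         * enorm (hidden thetastar x [::] y - hidden theta x [::] y).
Proof.
have sameW : unembed thetastar = unembed theta.
  by case: thetastar_ideal => s _ ->.
set h := hidden theta x [::] y; set h' := hidden thetastar x [::] y.
rewrite -mulrA.
apply: (@le_trans _ _ (2 * enorm (unembed theta *m (h' - h)))); last first.
  by rewrite ler_pM2l // enorm_mulmx.
(* [next_token] is by conversion the [softmax] of the logits. *)
apply: (@KL_softmax_le _ _ (logit theta x [::] y) (logit thetastar x [::] y)).
  exact: enorm_ge0.
(* Since the weights are shared, the change in the logit of [i] is a coordinate of
   [unembed theta *m (h' - h)]. *)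
move=> i; apply: le_trans (coord_le_enorm _ _ (enum_rank i)).
by rewrite !logitE sameW mulmxBr !mxE.
Qed.
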